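(* If $X$ is a separable AM-space, then for every $C > 1$ there exists a $C$-Benyamini space $X'$ and a surjective lattice isomorphism $\Phi : X \to X'$ such that for all $x\in X$, $\|x \| \leq \| \Phi(x) \| \leq C \| x \|$.
   Context: All spaces are over the real scalars. An AM-space is a Banach lattice in which $\| x \vee y \| = \max\{ \|x\|, \|y\| \}$ for all positive $x,y$. For $C>1$, a Banach lattice $X$ is called a $C$-Benyamini space if it is a (closed) sublattice of $C(K)$ with the sup norm, where: (1) $K$ is the one point compactification of the (topological) union of mutually disjoint compact Hausdorff sets $K_n$, $n \in \mathbb{N}$ (so $K = (\bigcup_n K_n) \cup \{\infty\}$); (2) every $x \in X$ vanishes at $\infty$; (3) $X$ separates points of each $K_n$ (for all distinct $t,s\in K_n$, there exists $x \in X$ with $x(t) \neq x(s)$); (4) if $t \in K_m$, $s \in K_n$, and $\lambda$ is a fixed scalar such that $x(t) = \lambda x(s)$ for all $x \in X$, then $\lambda = C^{n-m}$. *)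

(* Defs.v *)
From HB Require Import structures.
From mathcomp Require Import all_boot all_order all_algebra.
From mathcomp Require Import all_classical all_reals all_analysis.

Set Implicit Arguments.
Unset Strict Implicit.
Unset Printing Implicit Defensive.

Import Order.TTheory GRing.Theory Num.Theory.
Import numFieldNormedType.Exports.

Local Open Scope classical_set_scope.
Local Open Scope ring_scope.

(* Hierarchy-Builder accepts no new join of normed modules with ordered types,
   because the number structures inheriting from both are already declared.
   Hence the lattice is given by its class on the type of [bl_space]; a cast to
   [bl_lattice] selects the order. In [bl_norm], x \/ (-x) is the modulus of x,
   whereas `|x| is its norm. *)
Record banachLatticeType (R : realType) (d : Order.disp_t) := BanachLattice {
  bl_space :> completeNormedModType R;
  bl_class : Order.Lattice.axioms_ d bl_space;
  bl_lattice : latticeType d := Order.Lattice.Pack bl_class;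
  bl_leD2r : forall x y z : bl_space,
    (x <= y :> bl_lattice)%O -> (x + z <= y + z :> bl_lattice)%O;
  bl_leZ2l : forall (a : R) (x y : bl_space),
    0 <= a -> (x <= y :> bl_lattice)%O -> (a *: x <= a *: y :> bl_lattice)%O;
  bl_norm : forall x y : bl_space,
    (@Order.join d bl_lattice x (- x) <= @Order.join d bl_lattice y (- y)
       :> bl_lattice)%O ->
    `|x| <= `|y|
}.

Definition bl_join (R : realType) (d : Order.disp_t)
    (X : banachLatticeType R d) (x y : X) : X :=
  @Order.join d (bl_lattice X) x y.

Definition bl_meet (R : realType) (d : Order.disp_t)
    (X : banachLatticeType R d) (x y : X) : X :=
  @Order.meet d (bl_lattice X) x y.

Definition AM_space (R : realType) (d : Order.disp_t)
    (X : banachLatticeType R d) : Prop :=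
  forall x y : X, (0 <= x :> bl_lattice X)%O -> (0 <= y :> bl_lattice X)%O ->
    `|bl_join x y| = Num.max `|x| `|y|.

Definition separable (T : topologicalType) : Prop :=
  exists2 D : set T, countable D & dense D.

(* Only used for continuous functions on nonempty compact spaces, where the
   supremum is that of a nonempty bounded set. *)
Definition supnorm (R : realType) (K : Type) (f : K -> R) : R :=
  sup (range (fun t => `|f t|)).

Record closed_sublattice (R : realType) (K : topologicalType)
    (A : set (K -> R)) : Prop := {
  csl_continuous : forall f, A f -> continuous f;
  csl_zero : A (fun=> 0);
  csl_add : forall f g, A f -> A g -> A (fun t => f t + g t);
  csl_scale : forall (a : R) f, A f -> A (fun t => a * f t);
  csl_max : forall f g, A f -> A g -> A (fun t => Num.max (f t) (g t));
  csl_min : forall f g, A f -> A g -> A (fun t => Num.min (f t) (g t));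
  csl_closed : forall f, continuous f ->
    (forall e : R, 0 < e ->
       exists2 g, A g & supnorm (fun t => f t - g t) < e) ->
    A f
}.

(* The point at infinity is [None]; the topology on {n & Kn n} is that of the
   disjoint union. *)
Definition union_cpt (Kn : nat -> topologicalType) : topologicalType :=
  one_point_compactification {n : nat & Kn n}.

Definition pt_infty (Kn : nat -> topologicalType) : union_cpt Kn := None.

Definition pt (Kn : nat -> topologicalType) (n : nat) (t : Kn n) :
  union_cpt Kn := Some (existT Kn n t).

(* Some of the Kn may be empty: otherwise no space of dimension 0 would be a
   Benyamini space, since [bs_scaling] with a = 0 forbids all of A to vanish
   at a point of Kn. *)
Record Benyamini_space (R : realType) (C : R) (Kn : nat -> topologicalType)
    (A : set (union_cpt Kn -> R)) : Prop := {
  bs_compact : forall n, compact [set: Kn n];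
  bs_hausdorff : forall n, hausdorff_space (Kn n);
  bs_sublattice : closed_sublattice A;
  bs_infty : forall x, A x -> x (pt_infty Kn) = 0;
  bs_separates : forall n (t s : Kn n), t <> s ->
    exists2 x, A x & x (pt t) <> x (pt s);
  bs_scaling : forall m n (t : Kn m) (s : Kn n) (a : R),
    (forall x, A x -> x (pt t) = a * x (pt s)) ->
    a = C ^ (n%:Z - m%:Z)
}.

Record lattice_isomorphism (R : realType) (d : Order.disp_t)
    (X : banachLatticeType R d) (K : Type) (A : set (K -> R))
    (Phi : {linear X -> (K -> R^o)}) : Prop := {
  li_bij : set_bij [set: X] A Phi;
  li_join : forall x y t, Phi (bl_join x y) t = Num.max (Phi x t : R) (Phi y t);
  li_meet : forall x y t, Phi (bl_meet x y) t = Num.min (Phi x t : R) (Phi y t)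
}.

(* Main.v *)
Require Import Defs.
From HB Require Import structures.
From mathcomp Require Import all_boot all_order all_algebra.
From mathcomp Require Import all_classical all_reals all_analysis.
From mathcomp Require Import lra.

(** A lattice form is a linear functional that preserves binary joins. Choose
e >= 0 of norm at most 1, a weighted sum of the moduli of a dense sequence, so
that f e > 0 for every nonzero bounded lattice form f. Take for K_n the
pointwise compact set of the lattice forms f with |f| <= C |.| and f e = C^-n,
and let Phi be evaluation. Comparing values at e gives the scaling condition;
density gives f x -> 0 as n -> oo, uniformly in f \in K_n. For the lower norm
bound, a lattice form g of norm at most 1 attaining |x| at x has g e <= 1, so
that the multiple of g with value C^-n at e, where C^-(n+1) < g e <= C^-n, lies
in K_n and exceeds g by a factor in [1, C[. Such a g comes from a Hahn-Banach
argument in which every functional preserves joins. *)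

Set Implicit Arguments.
Unset Strict Implicit.
Unset Printing Implicit Defensive.

Import Order.TTheory GRing.Theory Num.Theory.
Import numFieldNormedType.Exports.

Local Open Scope classical_set_scope.
Local Open Scope ring_scope.

(** * Banach lattices *)

Section banach_lattice.
Context (R : realType) (d : Order.disp_t) (X : banachLatticeType R d).
Implicit Types x y z w : X.
Local Notation "x ≼ y" := (@Order.le d (bl_lattice X) x y) (at level 70).

Lemma bl_leUl x y : x ≼ bl_join x y.
Proof. exact: leUl. Qed.

Lemma bl_leUr x y : y ≼ bl_join x y.
Proof. exact: leUr. Qed.

Lemma bl_leUx x y z : x ≼ z -> y ≼ z -> bl_join x y ≼ z.
Proof. by move=> xz yz; rewrite /bl_join leUx xz yz. Qed.

(** Translation by [z] is an order automorphism, with inverse translation by [- z], and so commutes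
    with suprema. *)
Lemma bl_joinDr x y z : bl_join (x + z) (y + z) = bl_join x y + z.
Proof.
apply: (@le_anti d (bl_lattice X)); apply/andP; split.
  by apply: bl_leUx; apply: bl_leD2r; [exact: bl_leUl|exact: bl_leUr].
rewrite -[leRHS](subrK z); apply: bl_leD2r; apply: bl_leUx.
  by rewrite -[leLHS](addrK z); apply: bl_leD2r; exact: bl_leUl.
by rewrite -[leLHS](addrK z); apply: bl_leD2r; exact: bl_leUr.
Qed.

Lemma bl_joinZ (a : R) x y : 0 <= a ->
  bl_join (a *: x) (a *: y) = a *: bl_join x y.
Proof.
rewrite le_eqVlt => /predU1P[<-|a0].
  by rewrite !scale0r; exact: (@joinxx d (bl_lattice X)).
have aK z : a *: (a^-1 *: z) = z by rewrite scalerA divff ?gt_eqF ?scale1r.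
have Ka z : a^-1 *: (a *: z) = z by rewrite scalerA mulVf ?gt_eqF ?scale1r.
apply: (@le_anti d (bl_lattice X)); apply/andP; split.
  by apply: bl_leUx; (apply: bl_leZ2l; first exact: ltW);
    [exact: bl_leUl|exact: bl_leUr].
rewrite -[leRHS]aK; apply: bl_leZ2l; first exact: ltW.
by apply: bl_leUx; [rewrite -[leLHS]Ka|rewrite -[leLHS]Ka];
  (apply: bl_leZ2l; first by rewrite invr_ge0 ltW);
  [exact: bl_leUl|exact: bl_leUr].
Qed.

Lemma bl_joinACA0 x y :
  bl_join (bl_join x y) 0 = bl_join (bl_join x 0) (bl_join y 0).
Proof. by rewrite /bl_join joinACA joinxx. Qed.

Lemma bl_leN x y : x ≼ y -> - y ≼ - x.
Proof.
move=> xy; have := bl_leD2r (- x - y) xy.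
by rewrite addrA subrr sub0r addrC subrK.
Qed.

(** Negation is an order-reversing involution. Through this identity, forms that preserve joins also
    preserve meets. *)
Lemma bl_meetE x y : bl_meet x y = - bl_join (- x) (- y).
Proof.
apply: (@le_anti d (bl_lattice X)); apply/andP; split.
  rewrite -[leLHS]opprK; apply: bl_leN; apply: bl_leUx; apply: bl_leN.
    exact: (@leIl d (bl_lattice X)).
  exact: (@leIr d (bl_lattice X)).
rewrite /bl_meet lexI; apply/andP; split.
  by rewrite -[leRHS]opprK; apply: bl_leN; exact: bl_leUl.
by rewrite -[leRHS]opprK; apply: bl_leN; exact: bl_leUr.
Qed.

Lemma bl_abs_ge0 x : 0 ≼ bl_join x (- x).
Proof.
(* The modulus dominates both [x] and [- x]; adding the two inequalities gives twice the claim. *)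
have H : 0 ≼ bl_join x (- x) + bl_join x (- x).
  apply: (@le_trans d (bl_lattice X) (x + bl_join x (- x))).
    have := bl_leD2r x (bl_leUr x (- x)).
    by rewrite addNr addrC.
  exact: (bl_leD2r _ (bl_leUl x (- x))).
have h2 : 0 <= 2^-1 :> R by rewrite invr_ge0.
have := bl_leZ2l h2 H.
rewrite scaler0 -mulr2n -[bl_join _ _ *+ 2]scaler_nat scalerA.
by rewrite mulVf ?pnatr_eq0// scale1r.
Qed.

Lemma bl_abs_pos x : 0 ≼ x -> bl_join x (- x) = x.
Proof.
move=> x0; have Nx : - x ≼ x.
  apply: (@le_trans d (bl_lattice X) 0) => //.
  by have := bl_leD2r (- x) x0; rewrite sub0r subrr.
exact: (join_l Nx).
Qed.

Lemma bl_norm_mono x y : 0 ≼ x -> x ≼ y -> `|x| <= `|y|.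
Proof.
move=> x0 xy; have y0 : 0 ≼ y := @le_trans d (bl_lattice X) _ _ _ x0 xy.
by apply: bl_norm; rewrite -!/(bl_join _ _) !bl_abs_pos.
Qed.

(** [bl_norm] compares moduli, and the modulus of a modulus is itself. *)
Lemma bl_norm_abs x : `|bl_join x (- x)| = `|x|.
Proof.
by apply/le_anti/andP; split; apply: bl_norm;
  rewrite -!/(bl_join _ _) (bl_abs_pos (bl_abs_ge0 x)).
Qed.

(** The norm of the positive part: the sublinear majorant from which the Hahn-Banach argument
    starts. *)
Definition pos_norm x := `|bl_join x 0|.

Lemma pos_norm_le x : pos_norm x <= `|x|.
Proof.
rewrite -(bl_norm_abs x); apply: bl_norm_mono; first exact: bl_leUr.
by apply: bl_leUx; [exact: bl_leUl|exact: bl_abs_ge0].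
Qed.

Lemma pos_normD x y : pos_norm (x + y) <= pos_norm x + pos_norm y.
Proof.
apply: le_trans (ler_normD _ _); apply: bl_norm_mono; first exact: bl_leUr.
(* By translation invariance, the sum of the positive parts is the supremum of [x + y], [x], [y] and
   [0]. *)
have jD : bl_join x 0 + bl_join y 0 =
    bl_join (bl_join (x + y) x) (bl_join y 0).
  rewrite -bl_joinDr add0r [x + bl_join y 0]addrC -bl_joinDr add0r.
  by rewrite [y + x]addrC.
rewrite jD; apply: bl_leUx.
  apply: (@le_trans d (bl_lattice X) (bl_join (x + y) x)); exact: bl_leUl.
apply: (@le_trans d (bl_lattice X) (bl_join y 0)); exact: bl_leUr.
Qed.

Lemma pos_normZ (a : R) x : 0 <= a -> pos_norm (a *: x) = a * pos_norm x.
Proof.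
by move=> a0; rewrite /pos_norm -{1}(scaler0 _ a) bl_joinZ// normrZ ger0_norm.
Qed.

(** The positive part of a join is the join of the positive parts, to which the AM identity applies.
    All uses of the AM hypothesis go through this step. *)
Lemma pos_norm_join x y : AM_space X ->
  pos_norm (bl_join x y) = Num.max (pos_norm x) (pos_norm y).
Proof.
by move=> XAM; rewrite /pos_norm bl_joinACA0 XAM //; exact: bl_leUr.
Qed.

End banach_lattice.

(** * Join-preserving sublinear functionals *)

(** Near-minimizers of [f] and of [g] are in general different indices; directedness yields one
    index that serves both. *)
Lemma inf_max_directed (R : realType) (I : Type) (D : set I) (f g : I -> R) :
  D !=set0 -> has_lbound (f @` D) -> has_lbound (g @` D) ->
  (forall i j, D i -> D j -> exists k, [/\ D k, f k <= f i & g k <= g j]) ->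
  inf ((fun i => Num.max (f i) (g i)) @` D)
    = Num.max (inf (f @` D)) (inf (g @` D)).
Proof.
move=> [i0 Di0] lf lg dir.
have nf h : (h @` D : set R) !=set0 by exists (h i0), i0.
have lm : has_lbound ((fun i => Num.max (f i) (g i)) @` D).
  have [m mf] := lf; exists m => _ [i Di <-].
  by rewrite le_max mf//; exists i.
apply/le_anti/andP; split.
  apply/ler_addgt0Pr => e e0.
  have [_ [i Di <-] fi] := inf_adherent e0 (conj (nf f) lf).
  have [_ [j Dj <-] gj] := inf_adherent e0 (conj (nf g) lg).
  have [k [Dk fk gk]] := dir i j Di Dj.
  apply: (@le_trans _ _ (Num.max (f k) (g k))).
    by apply: ge_inf => //; exists k.
  rewrite addr_maxl ge_max !le_max.
  by rewrite (le_trans fk (ltW fi)) (le_trans gk (ltW gj)) orbT.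
rewrite ge_max; apply/andP; split; apply: lb_le_inf => // _ [i Di <-].
  apply: (@le_trans _ _ (f i)); last by rewrite le_max lexx.
  by apply: ge_inf => //; exists i.
apply: (@le_trans _ _ (g i)); [apply: ge_inf => //; exists i => //|].
by rewrite le_max lexx orbT.
Qed.

Section max_sublinear.
Context (R : realType) (V : lmodType R) (join : V -> V -> V).
Hypothesis joinD : forall x y z, join (x + z) (y + z) = join x y + z.

(** Preservation of joins is carried along with sublinearity, so that the linear functional obtained
    by minimality inherits it. *)
Definition max_sublinear (p : V -> R) :=
  [/\ forall x y, p (x + y) <= p x + p y,
      forall a x, 0 <= a -> p (a *: x) = a * p x &
      forall x y, p (join x y) = Num.max (p x) (p y)].

Lemma max_sublinear_geN p x : max_sublinear p -> - p (- x) <= p x.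
Proof.
case=> pD pZ _; have := pD x (- x); rewrite subrr.
by have := pZ 0 0 (lexx 0); rewrite scale0r mul0r => ->; lra.
Qed.

(* The largest sublinear q <= p with q (- x) <= - p x. The infimum is over a
   nonincreasing function of t, hence it commutes with binary maxima. *)
Definition descent (p : V -> R) (x y : V) : R :=
  inf ((fun t => p (y + t *: x) - t * p x) @` [set t | 0 <= t]).

Lemma descent_lbound p x y : max_sublinear p ->
  has_lbound ((fun t => p (y + t *: x) - t * p x) @` [set t | 0 <= t]).
Proof.
move=> [pD pZ _]; exists (- p (- y)) => _ [t /= t0 <-].
by have := pD (y + t *: x) (- y); rewrite addrAC subrr add0r pZ//; lra.
Qed.

Lemma descent_le p x y t : max_sublinear p -> 0 <= t ->
  descent p x y <= p (y + t *: x) - t * p x.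
Proof. by move=> mp t0; apply: ge_inf; [exact: descent_lbound|exists t]. Qed.

Lemma le_descent p x y m :
  (forall t, 0 <= t -> m <= p (y + t *: x) - t * p x) -> m <= descent p x y.
Proof.
move=> H; apply: lb_le_inf; first by exists (p (y + 0 *: x) - 0 * p x), 0 => /=.
by move=> _ [t /= t0 <-]; exact: H.
Qed.

Lemma descent_le_self p x y : max_sublinear p -> descent p x y <= p y.
Proof.
move=> mp; have := descent_le x y mp (lexx 0).
by rewrite scale0r addr0 mul0r subr0.
Qed.

Lemma descent_opp p x : max_sublinear p -> descent p x (- x) <= - p x.
Proof.
move=> mp; have := descent_le x (- x) mp ler01.
have [_ pZ _] := mp; have := pZ 0 0 (lexx 0).
by rewrite scale1r addNr !scale0r !mul0r mul1r => ->; rewrite sub0r.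
Qed.

(** Parameters [s] for [y] and [t] for [z] combine to [s + t] for the sum; homogeneity rescales the
    parameter; for joins, translation by [t *: x] commutes with [join], and the infimum then
    commutes with the maximum. *)
Lemma descent_max_sublinear p x :
  max_sublinear p -> max_sublinear (descent p x).
Proof.
move=> mp; have [pD pZ pj] := mp; split=> [y z|a y a0|y z].
- rewrite -lerBlDr; apply: le_descent => s s0; rewrite lerBlDr -lerBlDl.
  apply: le_descent => t t0; rewrite lerBlDl.
  apply: le_trans (descent_le _ _ mp (addr_ge0 s0 t0)) _.
  have := pD (y + s *: x) (z + t *: x).
  by rewrite addrACA -scalerDl; lra.
- have [->|an0] := eqVneq a 0.
    have p0 : p 0 = 0 by have := pZ 0 0 (lexx 0); rewrite scale0r mul0r.
    rewrite scale0r mul0r; apply/le_anti/andP; split.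
      by rewrite -[leRHS]p0; exact: descent_le_self.
    by apply: le_descent => t t0; rewrite add0r pZ// subrr.
  have agt0 : 0 < a by rewrite lt_neqAle eq_sym an0.
  apply/le_anti/andP; split.
    rewrite -ler_pdivrMl//; apply: le_descent => t t0; rewrite ler_pdivrMl//.
    apply: le_trans (descent_le _ _ mp (mulr_ge0 a0 t0)) _.
    by rewrite -scalerA -scalerDr pZ// mulrBr mulrA.
  apply: le_descent => t t0; rewrite -ler_pdivlMl//.
  have at0 : 0 <= a^-1 * t by rewrite mulr_ge0// invr_ge0.
  rewrite -[t](mulVKf an0) -scalerA -scalerDr pZ// -mulrA -mulrBr mulKf//.
  exact: descent_le.
- rewrite /descent -inf_max_directed; last 1 first.
  (* Subadditivity makes both functions nonincreasing in the parameter, so [s + t] lies below both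
     choices. *)
  + move=> s t s0 t0; exists (s + t); split => /=; first exact: addr_ge0.
      have := pD (y + s *: x) (t *: x).
      by rewrite -addrA -scalerDl pZ//; lra.
    have := pD (z + t *: x) (s *: x).
    by rewrite -addrA -scalerDl [t + s]addrC pZ//; lra.
  + by congr inf; apply: eq_imagel => t _; rewrite -joinD pj addr_maxl.
  + by exists 0 => /=.
  + exact: descent_lbound.
  + exact: descent_lbound.
Qed.

(** Each member is bounded below at [x] by [- q (- x)], so the infimum is finite. Any two members
    have one below both, which lets sums and maxima pass to the infimum. *)
Lemma max_sublinear_chain_inf (q : V -> R) (A : set (V -> R)) :
  A !=set0 -> A `<=` max_sublinear -> (forall p x, A p -> p x <= q x) ->
  total_on A (fun p p' => forall x, p' x <= p x) ->
  max_sublinear (fun x => inf ((fun p => p x) @` A)) /\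
  forall p x, A p -> inf ((fun p => p x) @` A) <= p x.
Proof.
move=> [p0 Ap0] Am Aq tot.
have lA x : has_lbound ((fun p => p x) @` A).
  exists (- q (- x)) => _ [p Ap <-].
  apply: le_trans (max_sublinear_geN x (Am _ Ap)).
  by rewrite lerN2 Aq.
have nA x : ((fun p => p x) @` A : set R) !=set0 by exists (p0 x), p0.
have leA p x : A p -> inf ((fun p => p x) @` A) <= p x.
  by move=> Ap; apply: ge_inf => //; exists p.
have dir p p' : A p -> A p' ->
    exists p'', [/\ A p'', forall x, p'' x <= p x & forall x, p'' x <= p' x].
  by move=> Ap Ap'; have [h|h] := tot _ _ Ap Ap'; [exists p'|exists p].
split=> //; split=> [x y|a x a0|x y].
- rewrite -lerBlDr; apply: lb_le_inf => // _ [p Ap <-].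
  rewrite lerBlDr -lerBlDl.
  apply: lb_le_inf => // _ [p' Ap' <-]; rewrite lerBlDl.
  have [p'' [Ap'' pp pp']] := dir _ _ Ap Ap'.
  apply: le_trans (leA _ _ Ap'') _; have [pD _ _] := Am _ Ap''.
  by apply: le_trans (pD _ _) _; exact: lerD.
- have [->|an0] := eqVneq a 0.
    have p0' p : A p -> p 0 = 0.
      by case/Am => _ /(_ 0 0 (lexx _)); rewrite scale0r mul0r.
    rewrite scale0r mul0r; apply/le_anti/andP; split.
      by rewrite -[leRHS](p0' p0)//; exact: leA.
    by apply: lb_le_inf => // _ [p Ap <-]; rewrite p0'.
  have agt0 : 0 < a by rewrite lt_neqAle eq_sym an0.
  apply/le_anti/andP; split.
    rewrite -ler_pdivrMl//; apply: lb_le_inf => // _ [p Ap <-].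
    rewrite ler_pdivrMl//; have [_ pZ _] := Am _ Ap.
    by rewrite -pZ//; exact: leA.
  apply: lb_le_inf => // _ [p Ap <-]; have [_ pZ _] := Am _ Ap.
  by rewrite pZ// ler_pM2l//; exact: leA.
- rewrite -inf_max_directed//.
  + by congr inf; apply: eq_imagel => p /Am[_ _ ->].
  + by exists p0.
  + move=> p p' Ap Ap'; have [p'' [Ap'' pp pp']] := dir _ _ Ap Ap'.
    by exists p''.
Qed.

Lemma max_sublinear_minimal q : max_sublinear q ->
  exists p, [/\ max_sublinear p, forall x, p x <= q x &
    forall p', max_sublinear p' -> (forall x, p' x <= p x) -> p' = p].
Proof.
move=> mq.
pose T := {p : V -> R | max_sublinear p /\ forall x, p x <= q x}.
(* The order is reversed, so that a maximal element from Zorn's lemma is a minimal functional. *)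
pose le (s t : T) := `[< forall x, sval t x <= sval s x >].
have q0 : T by exists q; split.
have [] := @ZL_preorder T q0 le.
- by move=> t; apply/asboolP.
- move=> r s t /asboolP h1 /asboolP h2; apply/asboolP => x.
  exact: le_trans (h2 x) (h1 x).
- move=> A tot; have [->|/set0P[t0 At0]] := eqVneq A set0; first by exists q0.
  pose B := sval @` A.
  have [] := @max_sublinear_chain_inf q B.
  + by exists (sval t0), t0.
  + by move=> _ [t At <-]; have [] := svalP t.
  + by move=> _ x [t At <-]; have [] := svalP t.
  + move=> _ _ [s As <-] [t At <-].
    by have [/asboolP|/asboolP] := tot _ _ As At; [left|right].
  + move=> mi lei.
    have iq x : inf ((fun p => p x) @` B) <= q x.
      apply: le_trans (lei (sval t0) x _) _; first by exists t0.
      by have [_] := svalP t0.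
    exists (exist _ (fun x => inf ((fun p => p x) @` B)) (conj mi iq)) => s As.
    apply/asboolP => x /=.
    by apply: lei; exists s.
- move=> [p [mp pq]] pmax; exists p; split=> // p' mp' p'p.
  have p'q x : p' x <= q x by exact: le_trans (p'p x) (pq x).
  have /asboolP /= pp' :
      le (exist _ p' (conj mp' p'q)) (exist _ p (conj mp pq) : T).
    by apply: pmax; apply/asboolP.
  by apply/funext => x; apply/le_anti; rewrite p'p pp'.
Qed.

(** A minimal [p] below [descent q x] is linear. Starting below the descent along [x] forces
    [p (- x) <= - q x], hence equality at [x]. *)
Lemma max_sublinear_Hahn_Banach (q : V -> R) (x : V) : max_sublinear q ->
  exists f : V -> R, [/\ forall a y z, f (a *: y + z) = a * f y + f z,
    forall y z, f (join y z) = Num.max (f y) (f z),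
    forall y, f y <= q y & f x = q x].
Proof.
move=> mq; have [p [mp pq pmin]] :=
  max_sublinear_minimal (descent_max_sublinear x mq).
have [pD pZ pj] := mp.
have pN y : p (- y) = - p y.
  apply/le_anti/andP; split; last first.
    by rewrite -lerN2 opprK; apply: max_sublinear_geN.
  (* By minimality [descent p y] equals [p], so the inequality for the descent at [- y] holds for
     [p], which is therefore odd. *)
  rewrite -{1}(pmin _ (descent_max_sublinear y mp)); first exact: descent_opp.
  by move=> z; exact: descent_le_self.
have pa y z : p (y + z) = p y + p z.
  apply/le_anti; rewrite pD/= -lerN2 opprD -!pN opprD; exact: pD.
have pq' y : p y <= q y by apply: le_trans (pq y) (descent_le_self _ _ mq).
exists p; split=> // [a y z|].
  rewrite pa; congr (_ + _); have [a0|a0] := leP 0 a; first exact: pZ.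
  rewrite -[a]opprK scaleNr pN pZ ?mulNr// oppr_ge0; exact: ltW.
apply/le_anti; rewrite pq'/= -lerN2 -pN.
exact: le_trans (pq _) (descent_opp _ mq).
Qed.

End max_sublinear.

(** * Lattice forms *)

Section lattice_form.
Context (R : realType) (d : Order.disp_t) (X : banachLatticeType R d).
Implicit Types (x y e : X) (f : X -> R) (B : R).

Record lattice_form (B : R) (f : X -> R) : Prop := LatticeForm {
  lf_linear : forall a x y, f (a *: x + y) = a * f x + f y;
  lf_join : forall x y, f (bl_join x y) = Num.max (f x) (f y);
  lf_bound : forall x, `|f x| <= B * `|x|
}.

Section lattice_form_theory.
Variables (B : R) (f : X -> R).
Hypothesis fB : lattice_form B f.

Lemma lf0 : f 0 = 0.
Proof.
have := lf_linear fB 1 0 0.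
rewrite scaler0 addr0 mul1r => /eqP.
by rewrite -subr_eq0 opprD addNKr oppr_eq0 => /eqP.
Qed.

Lemma lfZ a x : f (a *: x) = a * f x.
Proof. by have := lf_linear fB a x 0; rewrite lf0 !addr0. Qed.

Lemma lfD x y : f (x + y) = f x + f y.
Proof. by have := lf_linear fB 1 x y; rewrite scale1r mul1r. Qed.

Lemma lfN x : f (- x) = - f x.
Proof. by rewrite -scaleN1r lfZ mulN1r. Qed.

Lemma lfB x y : f (x - y) = f x - f y.
Proof. by rewrite lfD lfN. Qed.

Lemma lf_abs x : f (bl_join x (- x)) = `|f x|.
Proof. by rewrite (lf_join fB) lfN maxrN. Qed.

Lemma lf_meet x y : f (bl_meet x y) = Num.min (f x) (f y).
Proof. by rewrite bl_meetE lfN (lf_join fB) !lfN oppr_max !opprK. Qed.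

Lemma lf_continuous : continuous f.
Proof.
move=> x; apply/cvgrPdist_lt => eps eps0.
(* [B] may be zero or negative; this is a positive Lipschitz constant to divide by. *)
have B1 : 0 < `|B| + 1 by rewrite ltr_wpDl.
near=> y; rewrite -lfB; apply: le_lt_trans (lf_bound fB _) _.
apply: (@le_lt_trans _ _ ((`|B| + 1) * `|x - y|)).
  apply: ler_wpM2r => //; apply: le_trans (ler_norm _) _.
  by rewrite lerDl.
rewrite -ltr_pdivlMl//; near: y.
apply: (@cvgr_dist_lt _ _ _ _ _ id x) => //.
by rewrite mulr_gt0// invr_gt0.
Unshelve. all: by end_near. Qed.

Lemma lf_scale a : 0 <= a -> lattice_form (a * B) (fun x => a * f x).
Proof.
move=> a0; split=> [b x y|x y|x].
- by rewrite lfD lfZ mulrDr mulrCA.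
- by rewrite (lf_join fB) maxr_pMr.
- by rewrite normrM ger0_norm// -mulrA ler_wpM2l// (lf_bound fB).
Qed.

Lemma lf_le B' : B <= B' -> lattice_form B' f.
Proof.
move=> BB'; split=> [||x]; [exact: lf_linear fB|exact: lf_join fB|].
by apply: le_trans (lf_bound fB x) _; exact: ler_wpM2r.
Qed.

End lattice_form_theory.

Lemma norming_lattice_form x : AM_space X ->
  exists2 f, lattice_form 1 f & `|f x| = `|x|.
Proof.
move=> XAM; have mq : max_sublinear (@bl_join _ _ X) (@pos_norm _ _ X).
  split=> [y z|a y|y z]; first exact: pos_normD.
    exact: pos_normZ.
  exact: pos_norm_join.
(* The functional is made to attain [pos_norm] at the modulus of [x], where that value is the full
   norm of [x]; at [x] itself it could be smaller. *)
have [f [flin fj fq fx]] :=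
  max_sublinear_Hahn_Banach (@bl_joinDr _ _ X) (bl_join x (- x)) mq.
have fle y : f y <= `|y| := le_trans (fq y) (pos_norm_le y).
have f0 : f 0 = 0.
  by apply/le_anti; have := flin 1 0 0; rewrite scaler0 addr0; lra.
have fN y : f (- y) = - f y.
  by have := flin (-1) y 0; rewrite scaleN1r addr0 f0 addr0 mulN1r.
have fL : lattice_form 1 f.
  split=> // y; rewrite mul1r ler_norml fle andbT lerNl -fN.
  by rewrite -normrN; exact: fle.
exists f => //; rewrite -(lf_abs fL) fx /pos_norm.
have -> : bl_join (bl_join x (- x)) 0 = bl_join x (- x).
  exact: (join_l (bl_abs_ge0 x)).
exact: bl_norm_abs.
Qed.

(* Testing domination on lattice forms rather than in the order of X lets it
   pass to norm limits by mere continuity of the forms. *)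
Definition dominating e (u : nat -> X) := `|e| <= 1 /\
  forall k, exists2 M, 0 <= M &
    forall B f, lattice_form B f -> `|f (u k)| <= M * f e.

Lemma separable_dense_seq : separable X ->
  exists u : nat -> X,
    forall x (eps : R), 0 < eps -> exists k, `|x - u k| < eps.
Proof.
move=> [D /pfcard_geP[D0|[g]] Ddense].
  have [||x []] := Ddense setT; [by exists 0|exact: openT|].
  by rewrite D0.
exists g => x eps eps0.
have [||y [xy Dy]] := Ddense (ball x eps).
- by exists x; exact: ballxx.
- exact: ball_open.
- have [k _ gk] : (g @` setT) y by rewrite image_eq.
  by exists k; rewrite gk; move: xy; rewrite -ball_normE.
Qed.

Lemma dominating_ex (u : nat -> X) : exists e, dominating e u.
Proof.
(* Weights for which the [k]-th weighted modulus has norm at most [2^-1 ^+ k], so that the series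
   converges absolutely. *)
pose c k : R := 2^-1 ^+ k / (1 + `|u k|).
have u1 k : 0 < 1 + `|u k| by rewrite ltr_pwDl.
have c0 k : 0 < c k by rewrite divr_gt0// exprn_gt0.
pose a k := c k *: bl_join (u k) (- u k).
have cva : cvgn (series a).
  apply: normed_cvg; apply: (@series_le_cvg _ _ (geometric 1 2^-1)) => //.
  - by move=> n /=.
  - by move=> n; rewrite /geometric /= mul1r exprn_ge0.
  - move=> n; rewrite /geometric /= mul1r normrZ bl_norm_abs gtr0_norm//.
    rewrite /c -mulrA ler_piMr ?exprn_ge0// ler_pdivrMl// mulr1.
    by rewrite lerDr.
  - by apply: is_cvg_geometric_series; rewrite ger0_norm; lra.
pose e0 := limn (series a).
have e1 : 0 < 1 + `|e0| by rewrite ltr_pwDl.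
have fa B f : lattice_form B f -> forall k, f (a k) = c k * `|f (u k)|.
  by move=> fB k; rewrite /a (lfZ fB) (lf_abs fB).
have fe0 B f k : lattice_form B f -> c k * `|f (u k)| <= f e0.
  move=> fB; have cvf : f \o series a @ \oo --> f e0.
    by apply: continuous_cvg => //; exact: lf_continuous fB e0.
  rewrite -(cvg_lim (@Rhausdorff R) cvf); apply: limr_ge.
    by apply/cvg_ex; exists (f e0).
  (* Partial sums run over [i < n], so the [k]-th term is present from [k.+1] on; the other terms
     are nonnegative. *)
  exists k.+1 => // n /= kn.
  have -> : f (series a n) = \sum_(0 <= i < n) c i * `|f (u i)|.
    rewrite /series /=; elim/big_ind2 : _ => [|x1 y1 x2 y2 <- <-|i _].
    - exact: lf0 fB.
    - exact: lfD fB _ _.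
    - exact: fa fB i.
  rewrite (bigD1_seq k) ?mem_index_iota ?iota_uniq//=.
  by rewrite lerDl sumr_ge0// => i _; rewrite mulr_ge0// ltW.
(* Dividing by one plus the norm also covers [e0 = 0]; the factor reappears in the constant [M]
   below. *)
exists ((1 + `|e0|)^-1 *: e0); split.
  rewrite normrZ gtr0_norm ?invr_gt0// ler_pdivrMl// mulr1.
  by rewrite lerDr.
move=> k; exists ((c k)^-1 * (1 + `|e0|)).
  by rewrite mulr_ge0 ?invr_ge0 ?ltW.
move=> B f fB; rewrite (lfZ fB) -mulrA mulVKf ?gt_eqF// ler_pdivlMl//.
exact: fe0 fB.
Qed.

(** * Positivity, decay and norming for forms on a dominating element *)

Section dominating_theory.
Context (e : X) (u : nat -> X) (C : R).
Hypothesis (wu : dominating e u) (C1 : 1 < C).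
Hypothesis u_dense : forall x (eps : R), 0 < eps -> exists k, `|x - u k| < eps.

Let C0 : 0 < C. Proof. exact: lt_trans C1. Qed.

(** If [f e <= 0], domination makes [f] vanish at every [u k], hence everywhere by density and
    boundedness. *)
Lemma lf_dominating_gt0 B f x : lattice_form B f -> f x != 0 -> 0 < f e.
Proof.
move=> fB fx; rewrite ltNge; apply: contra fx => fe0.
have fu k : f (u k) = 0.
  apply/eqP; rewrite -normr_le0; have [M M0 /(_ B f fB)] := wu.2 k.
  by move=> /le_trans; apply; rewrite mulr_ge0_le0.
rewrite -normr_le0; apply/ler_addgt0Pl => eps eps0; rewrite addr0.
have B1 : 0 < `|B| + 1 by rewrite ltr_wpDl.
have [|k xk] := @u_dense x (eps / (`|B| + 1)); first by rewrite divr_gt0.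
rewrite -[f x]subr0 -(fu k) -(lfB fB); apply: le_trans (lf_bound fB _) _.
apply: (@le_trans _ _ ((`|B| + 1) * `|x - u k|)).
  apply: ler_wpM2r => //; apply: le_trans (ler_norm _) _.
  by rewrite lerDl.
by rewrite -ler_pdivlMl// mulrC ltW.
Qed.

Lemma geometric_small (M eps : R) : 0 < eps ->
  exists N, forall n, (N <= n)%N -> M * C ^- n < eps.
Proof.
move=> eps0.
have CV : `|C^-1| < 1 by rewrite ger0_norm ?invr_ge0 ?(ltW C0)// invf_lt1.
have := cvg_geometric M CV => /cvgrPdist_lt /(_ _ eps0)[N _ HN].
exists N => n Nn; have := HN n Nn; rewrite /geometric /= sub0r normrN exprVn.
exact: le_lt_trans (ler_norm _).
Qed.

(** Replacing [x] by a close [u k] costs at most [eps / 2] for all forms of bound [C] at once, and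
    domination leaves [M * C ^- n]. The uniformity in [f] gives continuity at infinity. *)
Lemma lf_vanish x eps : 0 < eps -> exists N, forall n f, (N <= n)%N ->
  lattice_form C f -> f e = C ^- n -> `|f x| < eps.
Proof.
move=> eps0; have [|k xk] := @u_dense x (eps / 2 / C).
  by rewrite !divr_gt0.
have [M M0 HM] := wu.2 k.
have [|N HN] := @geometric_small M (eps / 2); first by rewrite divr_gt0.
exists N => n f Nn fC fe; rewrite -[x](subrK (u k)) (lfD fC).
apply: le_lt_trans (ler_normD _ _) _; rewrite (splitr eps); apply: ltrD.
  apply: le_lt_trans (lf_bound fC _) _.
  by rewrite -ltr_pdivlMl// mulrC.
apply: le_lt_trans (HM _ _ fC) _; rewrite fe; exact: HN.
Qed.

Lemma norming_level x : AM_space X -> x != 0 -> exists n f,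
  [/\ lattice_form C f, f e = C ^- n & `|x| <= `|f x|].
Proof.
move=> XAM x0; have [g g1 gx] := norming_lattice_form x XAM.
have ge0 : 0 < g e.
  by apply: (lf_dominating_gt0 g1 (x := x)); rewrite -normr_gt0 gx normr_gt0.
have ge1 : g e <= 1.
  apply: le_trans (ler_norm _) _; apply: le_trans (lf_bound g1 _) _.
  by rewrite mul1r wu.1.
have : exists n, C ^- n.+1 < g e.
  have [N HN] := @geometric_small 1 _ ge0; exists N.
  by rewrite -[_ ^- _]mul1r; apply: HN.
move=> /ex_minnP[n gn nmin].
(* For [n = 0] this is [g e <= 1]; otherwise it is the minimality of [n]. *)
have gn' : g e <= C ^- n.
  case: n gn nmin => [_ _|n _ nmin]; first by rewrite expr0 invr1.
  by rewrite leNgt; apply/negP => /nmin; rewrite ltnn.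
pose r := C ^- n / g e.
have r1 : 1 <= r by rewrite ler_pdivlMr// mul1r.
have rC : r <= C.
  rewrite ler_pdivrMr// -ler_pdivrMl// -invfM -exprS; exact: ltW.
have r0 : 0 <= r by apply: le_trans r1.
exists n, (fun y => r * g y); split.
- by apply: (lf_le (lf_scale g1 r0)); rewrite mulr1.
- by rewrite divfK// gt_eqF.
- by rewrite normrM gx ger0_norm// ler_peMl.
Qed.

End dominating_theory.

End lattice_form.

(** * The compact spaces *)

(** A filter on the subtype is pushed forward along the inclusion; its cluster point in [A] lifts
    back, since open sets of the subtype are traces of open sets. *)
Lemma compact_set_type (T : topologicalType) (A : set T) :
  compact A -> compact [set: set_type A].
Proof.
move=> cA F PF _; pose G : set_system T := set_val @ F.
have GA : G A by apply: (@filterE _ F) => x; exact: set_valP.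
have [p [Ap clp]] := cA G _ GA.
exists (SigSub (mem_set Ap)); split=> // P Q FP [Q' [[W oW <-] Wp WQ]].
have GP : G (set_val @` P) by apply: (@filterS _ F _ P) => // x Px; exists x.
have [_ [[x Px <-] Wx]] := clp _ _ GP (open_nbhs_nbhs (conj oW Wp)).
by exists x; split=> //; exact: WQ.
Qed.

Lemma hausdorff_set_type (T : topologicalType) (A : set T) :
  hausdorff_space T -> hausdorff_space (set_type A).
Proof.
move=> hT p q clpq; apply: val_inj; apply: hT => P Q pP qQ.
have cv := @initial_continuous (set_type A) T set_val.
by have [x [Px Qx]] := clpq _ _ (cv p _ pP) (cv q _ qQ); exists (set_val x).
Qed.

Section real_continuous.
Context (R : realType) (T : topologicalType).
Implicit Types f g : T -> R.

Lemma continuous_lincomb (a : R) f g : continuous f -> continuous g ->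
  continuous (fun t => a * f t + g t).
Proof.
move=> cf cg t; apply: cvgD; last exact: cg.
by apply: cvgM; [exact: cvg_cst|exact: cf].
Qed.

Lemma continuous_diff f g : continuous f -> continuous g ->
  continuous (fun t => f t - g t).
Proof. by move=> cf cg t; apply: cvgB; [exact: cf|exact: cg]. Qed.

Lemma closed_eq_continuous f g : continuous f -> continuous g ->
  closed [set t | f t = g t].
Proof.
move=> cf cg.
have -> : [set t | f t = g t] = (fun t => f t - g t) @^-1` [set 0].
  apply/seteqP; split=> t /= => [->|/eqP]; first by rewrite subrr.
  by rewrite subr_eq0 => /eqP.
apply: preimage_closed; last exact: closed_eq.
by move=> t _; exact: continuous_diff.
Qed.

End real_continuous.

(** * Continuity and sup norm on the compactified disjoint union *)

Section union_cpt_theory.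
Context (R : realType) (Kn : nat -> topologicalType).
Hypothesis Kn_compact : forall n, compact [set: Kn n].

Lemma union_cpt_continuous (f : union_cpt Kn -> R) :
  (forall n, continuous (fun t : Kn n => f (pt t))) ->
  (forall eps, 0 < eps -> exists N, forall n (t : Kn n), (N <= n)%N ->
     `|f (pt t) - f (pt_infty Kn)| < eps) ->
  continuous f.
Proof.
move=> cf f_oo [[n t]|].
  by move=> U fU; exact: (cf n t U fU).
move=> U /nbhs_ballP[eps /= eps0 epsU]; have [N HN] := f_oo eps eps0.
(* The first [N] pieces form a closed compact set, whose complement together with infinity is a
   neighbourhood of infinity. *)
pose W : set {n & Kn n} := [set p | (projT1 p < N)%N].
have Wcompact : compact W.
  have -> : W = \big[setU/set0]_(i < N) (existT Kn i @` [set: Kn i]).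
    rewrite -(bigcup_mkord N (fun i => existT Kn i @` [set: Kn i])).
    apply/seteqP; split=> [[i t] /= iN|_ [i /= iN] [t _ <-]//].
    by exists i => //; exists t.
  apply: bigsetU_compact => i _.
  apply: continuous_compact; last exact: Kn_compact.
  exact/continuous_subspaceT/existT_continuous.
have Wclosed : closed W.
  rewrite -openC; apply/sigT_openP => i; have [iN|iN] := ltnP i N.
    have -> : existT Kn i @^-1` (~` W) = set0; last exact: open0.
    by apply/seteqP; split=> t //=.
  have -> : existT Kn i @^-1` (~` W) = setT; last exact: openT.
  by apply/seteqP; split=> t //= _; apply/negP; rewrite -leqNgt.
exists W => // _ [[[n t] /= nW <-]|->]; last first.
  by apply: epsU; exact: ballxx.
apply: epsU; rewrite -ball_normE /= distrC.
by apply: HN; rewrite leqNgt; exact/negP.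
Qed.

Lemma supnorm_ge (f : union_cpt Kn -> R) t : continuous f ->
  `|f t| <= supnorm f.
Proof.
move=> cf; apply: sup_upper_bound; last by exists t.
split; first by exists `|f t|, t.
have : bounded_set (f @` [set: union_cpt Kn]).
  apply: compact_bounded; apply: continuous_compact.
    exact: continuous_subspaceT.
  exact: one_point_compactification_compact.
move=> [M [_ HM]]; exists (M + 1) => _ [s _ <-].
by apply: (HM (M + 1)); [rewrite ltrDl|exists s].
Qed.

Lemma supnorm_le (f : union_cpt Kn -> R) M :
  (forall t, `|f t| <= M) -> supnorm f <= M.
Proof.
move=> fM; apply: ge_sup; first by exists `|f (pt_infty Kn)|, (pt_infty Kn).
by move=> _ [t _ <-].
Qed.

End union_cpt_theory.

(** * Levels of lattice forms as compact Hausdorff spaces *)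

Section level.
Context (R : realType) (d : Order.disp_t) (X : banachLatticeType R d).
Context (C : R) (e : X).

Definition level_set (n : nat) : set {ptws X -> R} :=
  [set f | lattice_form C f /\ f e = C ^- n].

Definition level (n : nat) : topologicalType := set_type (level_set n).

Lemma eval_continuous (x : X) : continuous (fun f : {ptws X -> R} => f x).
Proof. exact: (@proj_continuous X (fun=> R) x). Qed.

Lemma level_set_compact n : compact (level_set n).
Proof.
have ceval := eval_continuous.
(* The norm bound describes a product of segments, compact by Tychonoff; the remaining conditions
   compare finitely many coordinates at a time and are closed. *)
have -> : level_set n =
    (\bigcap_(p in [set: R * X * X])
       [set f | f (p.1.1 *: p.1.2 + p.2) = p.1.1 * f p.1.2 + f p.2]) `&`
    (\bigcap_(p in [set: X * X])
       [set f | f (bl_join p.1 p.2) = Num.max (f p.1) (f p.2)]) `&`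
    [set f | f e = C ^- n] `&`
    [set f | forall x, `[- (C * `|x|), C * `|x|]%classic (f x)].
  apply/seteqP; split=> f.
    move=> [[flin fj fb] fe]; split; first by split=> //; split=> p _.
    by move=> x; rewrite /= in_itv /= -ler_norml.
  move=> [[[flin fj] fe] fb]; split=> //; split.
  - by move=> a x y; exact: (flin (a, x, y)).
  - by move=> x y; exact: (fj (x, y)).
  - by move=> x; have := fb x; rewrite /= in_itv /= -ler_norml.
rewrite setIC; apply: compact_closedI.
  apply: (@tychonoff X (fun=> R) (fun x => `[- (C * `|x|), C * `|x|]%classic)).
  by move=> x; exact: segment_compact.
apply: closedI; first apply: closedI.
- apply: closed_bigI => -[[a x] y] _ /=; apply: closed_eq_continuous => //.
  by apply: continuous_lincomb; exact: ceval.
- apply: closed_bigI => -[x y] _ /=; apply: closed_eq_continuous => //.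
  by move=> f; apply: (@continuous_max R); exact: ceval.
- by apply: closed_eq_continuous; [exact: ceval|exact: cst_continuous].
Qed.

Lemma level_compact n : compact [set: level n].
Proof. exact/compact_set_type/level_set_compact. Qed.

Lemma level_hausdorff n : hausdorff_space (level n).
Proof.
apply: hausdorff_set_type.
exact: (@hausdorff_product X (fun=> R) (fun=> @Rhausdorff R)).
Qed.

Lemma levelP n (t : level n) :
  lattice_form C (set_val t) /\ set_val t e = C ^- n.
Proof. by have [] := @set_valP _ (level_set n) t. Qed.

Lemma level_eval_continuous n (x : X) :
  continuous (fun t : level n => set_val t x).
Proof.
move=> t U Ux; have := @eval_continuous x (set_val t) U Ux.
exact: (@initial_continuous (set_type (level_set n)) {ptws X -> R} set_val).
Qed.

End level.

(** * The representation *)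

Section representation.
Context (R : realType) (d : Order.disp_t) (X : banachLatticeType R d).
Context (C : R) (e : X) (u : nat -> X).
Hypotheses (C1 : 1 < C) (wu : dominating e u).
Hypothesis u_dense :
  forall x (eps : R), 0 < eps -> exists k, `|x - u k| < eps.
Hypothesis X_AM : AM_space X.

Local Notation Kn := (level C e).

Definition evaluation (x : X) : union_cpt Kn -> R^o :=
  fun p => if p is Some q then set_val (projT2 q) x else 0.

Let C0 : 0 < C. Proof. exact: lt_trans C1. Qed.

Lemma evaluation_linear : linear evaluation.
Proof.
move=> a x y; apply/funext => -[[n t]|]; last first.
  by rewrite /evaluation /= [RHS](_ : _ = a * 0 + 0 :> R)// mulr0 addr0.
by have [tC _] := levelP t; exact: (lf_linear tC).
Qed.

HB.instance Definition _ :=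
  GRing.isLinear.Build R X (union_cpt Kn -> R^o) _ evaluation evaluation_linear.

Lemma evaluationB x y p :
  evaluation (x - y) p = evaluation x p - evaluation y p.
Proof. by rewrite linearB. Qed.

Lemma evaluation_join x y p :
  evaluation (bl_join x y) p = Num.max (evaluation x p : R) (evaluation y p).
Proof.
case: p => [[n t]|] /=; last by rewrite maxxx.
by have [tC _] := levelP t; exact: (lf_join tC).
Qed.

Lemma evaluation_meet x y p :
  evaluation (bl_meet x y) p = Num.min (evaluation x p : R) (evaluation y p).
Proof.
case: p => [[n t]|] /=; last by rewrite minxx.
by have [tC _] := levelP t; exact: (lf_meet tC).
Qed.

Lemma evaluation_bound x p : `|evaluation x p : R| <= C * `|x|.
Proof.
case: p => [[n t]|] /=; last by rewrite normr0 mulr_ge0// ltW.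
by have [tC _] := levelP t; exact: (lf_bound tC).
Qed.

Lemma evaluation_continuous x : continuous (evaluation x : _ -> R).
Proof.
apply: union_cpt_continuous; first exact: level_compact.
  by move=> n; exact: level_eval_continuous.
move=> eps eps0; have [N HN] := lf_vanish wu C1 u_dense x eps0.
exists N => n t Nn; rewrite subr0; have [tC te] := levelP t.
exact: HN tC te.
Qed.

Lemma supnorm_evaluation x :
  `|x| <= supnorm (evaluation x : union_cpt Kn -> R) <= C * `|x|.
Proof.
apply/andP; split; last exact: (@supnorm_le R Kn _ _ (evaluation_bound x)).
(* If [X] is zero, every level is empty; the value at infinity then serves. *)
have [->|x0] := eqVneq x 0.
  rewrite normr0; apply: le_trans (supnorm_ge (pt_infty Kn) _) => //.
  exact: evaluation_continuous.
have [n [f [fC fe xf]]] := norming_level wu C1 u_dense X_AM x0.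
pose t : Kn n := SigSub (mem_set (conj fC fe : level_set C e n f)).
apply: le_trans xf _.
exact: (@supnorm_ge R Kn _ (pt t) (@evaluation_continuous x)).
Qed.

Lemma evaluation_inj : injective evaluation.
Proof.
move=> x y xy; apply/eqP; rewrite -subr_eq0 -normr_le0.
have /andP[H _] := supnorm_evaluation (x - y); apply: le_trans H _.
by apply: supnorm_le => p; rewrite evaluationB xy subrr normr0.
Qed.

(** The lower norm estimate makes preimages of approximants a Cauchy sequence; the upper one shows
    that [f] is the evaluation of its limit. *)
Lemma evaluation_range_closed (f : union_cpt Kn -> R) : continuous f ->
  (forall eps : R, 0 < eps ->
    exists2 g, range evaluation g & supnorm (fun t => f t - g t) < eps) ->
  range evaluation f.
Proof.
move=> cf approx.
have approx' n : exists x, forall p, `|f p - evaluation x p| < n.+1%:R^-1.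
  have [//|_ [x _ <-] fx] := approx n.+1%:R^-1.
  exists x => p; apply: le_lt_trans fx.
  apply: (@supnorm_ge R Kn (fun t => f t - evaluation x t) p).
  exact: (continuous_diff cf (@evaluation_continuous x)).
pose x n := sval (cid (approx' n)).
have xP n p : `|f p - evaluation (x n) p| < n.+1%:R^-1.
  exact: svalP (cid (approx' n)) p.
have xB m n : `|x m - x n| <= m.+1%:R^-1 + n.+1%:R^-1.
  have /andP[H _] := supnorm_evaluation (x m - x n); apply: le_trans H _.
  apply: supnorm_le => p; rewrite evaluationB.
  have -> : evaluation (x m) p - evaluation (x n) p =
      - (f p - evaluation (x m) p) + (f p - evaluation (x n) p) :> R.
    by rewrite opprB addrA subrK.
  apply: le_trans (ler_normD _ _) _.
  by rewrite normrN lerD// ltW.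
have inv_small (eps : R) : 0 < eps ->
    \forall n \near \oo, n.+1%:R^-1 < eps.
  move=> eps0.
  have := @cvg_harmonic R => /cvgrPdist_lt /(_ _ eps0); apply: filterS => n.
  by rewrite sub0r normrN /harmonic /= ger0_norm.
have cx : cvgn x.
  apply/cauchy_cvgP/cauchy_ballP => eps eps0.
  have eps2 : 0 < eps / 2 by rewrite divr_gt0.
  have [N _ HN] := inv_small _ eps2.
  pose Q := x @` [set n | (N <= n)%N].
  exists (Q, Q) => /=; first by split; exists N => // n Nn; exists n.
  move=> [_ _] [[m Nm <-] [n Nn <-]]; rewrite -ball_normE /=.
  by apply: le_lt_trans (xB _ _) _; rewrite (splitr eps) ltrD// HN.
exists (limn x) => //; apply/funext => p; apply/eqP.
rewrite eq_sym -subr_eq0 -normr_le0.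
apply/ler_addgt0Pl => eps eps0; rewrite addr0.
have eps2 : 0 < eps / 2 by rewrite divr_gt0.
have eps2C : 0 < eps / 2 / C by rewrite divr_gt0.
near \oo => n.
have -> : f p - evaluation (limn x) p =
    (f p - evaluation (x n) p) + evaluation (x n - limn x) p :> R.
  by rewrite evaluationB addrA subrK.
apply: le_trans (ler_normD _ _) _; rewrite (splitr eps); apply: lerD.
  apply: le_trans (ltW (xP n p)) _; apply: ltW.
  by near: n; exact: inv_small.
apply: le_trans (evaluation_bound _ _) _.
rewrite -ler_pdivlMl// mulrC distrC; apply: ltW.
by near: n; apply: (@cvgr_dist_lt _ _ _ _ _ x (limn x)).
Unshelve. all: by end_near. Qed.

Lemma evaluation_sublattice :
  closed_sublattice (range evaluation : set (union_cpt Kn -> R)).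
Proof.
split.
- by move=> _ [x _ <-]; exact: evaluation_continuous.
- by exists 0 => //; rewrite linear0.
- by move=> _ _ [x _ <-] [y _ <-]; exists (x + y) => //; rewrite linearD.
- by move=> a _ [x _ <-]; exists (a *: x) => //; rewrite linearZ.
- move=> _ _ [x _ <-] [y _ <-]; exists (bl_join x y) => //.
  by apply/funext => p; exact: evaluation_join.
- move=> _ _ [x _ <-] [y _ <-]; exists (bl_meet x y) => //.
  by apply/funext => p; exact: evaluation_meet.
- exact: evaluation_range_closed.
Qed.

Lemma evaluation_Benyamini :
  Benyamini_space C (range evaluation : set (union_cpt Kn -> R)).
Proof.
split.
- exact: level_compact.
- exact: level_hausdorff.
- exact: evaluation_sublattice.
- by move=> _ [x _ <-].
- move=> n t s ts; apply: contrapT => H; apply: ts; apply: val_inj.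
  apply/funext => x; apply: contrapT => xts; apply: H.
  by exists (evaluation x) => //; exists x.
(* Testing the relation on the evaluation of [e] gives [C ^- m = a * C ^- n]. *)
- move=> m n t s a ats; have [_ te] := levelP t; have [_ se] := levelP s.
  have := ats _ (imageT evaluation e); rewrite /= te se => Cmn.
  have Cn0 : C ^+ n != 0 by rewrite expf_neq0// gt_eqF.
  by rewrite expfzDr ?gt_eqF// -exprnN Cmn mulrCA divff ?mulr1.
Qed.

End representation.

Theorem proposition2p3 (R : realType) (d : Order.disp_t)
    (X : banachLatticeType R d) (X_AM : AM_space X) (X_sep : separable X)
    (C : R) (C_gt1 : 1 < C) :
  exists (Kn : nat -> topologicalType) (X' : set (union_cpt Kn -> R)),
    Benyamini_space C X' /\
    exists Phi : {linear X -> (union_cpt Kn -> R^o)},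
      lattice_isomorphism X' Phi /\
      forall x : X, `|x| <= supnorm (Phi x : union_cpt Kn -> R) <= C * `|x|.
Proof.
have [u u_dense] := separable_dense_seq X_sep.
have [e wu] := dominating_ex u.
exists (level C e), (range (@evaluation R d X C e)); split.
  exact: (evaluation_Benyamini C_gt1 wu u_dense X_AM).
exists (@evaluation R d X C e : {linear X -> (union_cpt (level C e) -> R^o)}).
split; last exact: (supnorm_evaluation C_gt1 wu u_dense X_AM).
split.
- split=> [x _|x y _ _|_ [x _ <-]]; [by exists x| |by exists x].
  exact: (evaluation_inj C_gt1 wu u_dense X_AM).
- exact: evaluation_join.
- exact: evaluation_meet.
Qed.
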